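(* Let $N\ge3$, $j\in\{1,\dots,N\}$, and let $\mathbf c:[a,b]\to\mathbb R^{N+1}$ be an (open) curve that is mildly smoothly turning at order $j+1$. Then the osculating $(j+1)$-space $\Pi^{j+1}(\mathbf c,s)$ is well-defined and continuous, as $s\in\,]a,b[$.
   Context: Let $\mathbf c:[a,b]\to\mathbb R^{N+1}$ be an open rectifiable curve parameterized by arc-length, $\mathbf c^{(k)}$ its $k$-th arc-length derivative. It is mildly smoothly turning at order $j+1$, $j\in\{1,\dots,N\}$, if for each $s\in[a,b]$ the function $\mathbf c$ is of class $C^m$ in a neighborhood of $s$, for some integer $m\ge j+2$, and there exist $j$ integers $1<i_2<\dots<i_{j+1}<m$ such that the $(j+1)$-vector $(\dot{\mathbf c}\wedge\mathbf c^{(i_2)}\wedge\cdots\wedge\mathbf c^{(i_{j+1})})(s)$ is non-trivial. The osculating $(j+1)$-space to the curve at $\mathbf c(s)$ is $\Pi^{j+1}(\mathbf c,s)=\mathbf c(s)+\mathrm{span}\{\dot{\mathbf c}(s),\mathbf c^{(i_2)}(s),\dots,\mathbf c^{(i_{j+1})}(s)\}$, where $1<i_2<\dots<i_{j+1}$ are the smallest integers such that $(\dot{\mathbf c}\wedge\mathbf c^{(i_2)}\wedge\cdots\wedge\mathbf c^{(i_{j+1})})(s)$ is non-trivial. Continuity is meant with respect to the canonical metric on the set of unoriented $(j+1)$-planes (equivalently, continuity of the unit $(j+1)$-vector orienting the plane, up to sign). *)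

(* Defs.v *)
From HB Require Import structures.
From mathcomp Require Import all_boot all_order all_algebra.
From mathcomp Require Import all_classical all_reals all_analysis.

Set Implicit Arguments.
Unset Strict Implicit.
Unset Printing Implicit Defensive.

Import Order.TTheory GRing.Theory Num.Theory.
Import numFieldNormedType.Exports.

Local Open Scope classical_set_scope.
Local Open Scope ring_scope.

Section DerivativesOnASet.
Context {R : realType} {V : normedModType R}.
Implicit Types (A : set R) (f : R -> V).

(* A curve [a, b] -> V is encoded by a total function R -> V whose values
   outside [a, b] are irrelevant: derivatives are limits of difference
   quotients taken inside A = `[a, b] (one-sided at the end points). *)
Definition diff_quotient f (x : R) : R -> V :=
  fun t => (t - x)^-1 *: (f t - f x).

Definition derivable_on A f (x : R) : Prop :=
  cvg (diff_quotient f x @ within A x^').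

Definition deriv_on A f (x : R) : V :=
  lim (diff_quotient f x @ within A x^').

Definition derivn_on A (k : nat) f : R -> V := iter k (deriv_on A) f.

(* f is of class C^m in a neighbourhood of s, relatively to A *)
Definition class_C_near A (m : nat) f (s : R) : Prop :=
  \forall t \near within A (nbhs s),
    (forall k, (k < m)%N -> derivable_on A (derivn_on A k f) t) /\
    derivn_on A m f x @[x --> within A (nbhs t)] --> derivn_on A m f t.

End DerivativesOnASet.

Section ArcLength.
Context {R : realType} {n : nat}.
Implicit Types (c : R -> 'rV[R]_n) (a b : R).

(* The library norm on 'rV[R]_n is the sup norm, hence this definition. *)
Definition eucl_norm (v : 'rV[R]_n) : R := Num.sqrt (\sum_i v ord0 i ^+ 2).

(* Length of the polygonal line inscribed in c with vertices at the points of
   the partition a :: p; compare [variation] for real-valued functions. *)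
Definition polygonal_length c a (p : seq R) : R :=
  \sum_(0 <= i < size p)
    eucl_norm (c (nth a (a :: p) i.+1) - c (nth a (a :: p) i)).

Definition curve_length a b c : \bar R :=
  ereal_sup [set (polygonal_length c a p)%:E | p in itv_partition a b].

Definition rectifiable a b c : Prop := (curve_length a b c < +oo)%E.

Definition arclength_parametrized a b c : Prop :=
  forall s, a <= s <= b -> curve_length a s c = (s - a)%:E.

End ArcLength.

Section Multivectors.
Context {R : realType} (k n : nat).

(* Strictly increasing multi-indices, which index the standard basis of the
   k-th exterior power of R^n. *)
Definition multiindex :=
  {l : {ffun 'I_k -> 'I_n} |
    [forall x : 'I_k, forall y : 'I_k, (x < y)%N ==> (l x < l y)%N]}.

(* k-vectors, given by their coordinates in the standard basis. *)
Definition kvector := {ffun multiindex -> R}.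

Definition kvector_norm (w : kvector) : R := Num.sqrt (\sum_l w l ^+ 2).

(* Exterior product of the k rows of v: its coordinates are the k x k minors. *)
Definition wedge (v : 'M[R]_(k, n)) : kvector :=
  [ffun l : multiindex => \det (colsub (val l) v)].

End Multivectors.

Section Planes.
Context {R : realType} (k n : nat).

(* x + span of the rows of v *)
Definition affine_span (x : 'rV[R]_n) (v : 'M[R]_(k, n)) : set 'rV[R]_n :=
  [set y | (y - x <= v)%MS].

(* w is one of the two unit simple k-vectors orienting the affine k-plane P *)
Definition orients (P : set 'rV[R]_n) (w : @kvector R k n) : Prop :=
  kvector_norm w = 1 /\
  exists x (v : 'M[R]_(k, n)), P = affine_span x v /\ w = wedge v.

(* Distance between unoriented k-planes: the quotient, by the change of sign
   of the orientation, of the distance between orienting unit k-vectors.  It is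
   +oo as soon as P or Q is not a k-plane. *)
Definition plane_dist (P Q : set 'rV[R]_n) : \bar R :=
  ereal_inf [set (kvector_norm (v - w))%:E | v in orients P & w in orients Q].

End Planes.

Section Osculating.
Context {R : realType} {n : nat}.
Variables (a b : R) (j : nat) (c : R -> 'rV[R]_n).

(* rows c^(i_1)(s), ..., c^(i_(j+1))(s) *)
Definition deriv_rows (s : R) (i : j.+1.-tuple nat) : 'M[R]_(j.+1, n) :=
  \matrix_(k < j.+1) derivn_on `[a, b] (tnth i k) c s.

(* 1 = i_1 < i_2 < ... < i_(j+1) < m, where c is C^m near s and m >= j + 2, and
   the (j+1)-vector of the corresponding derivatives at s is nontrivial *)
Definition turning_indices (s : R) (i : j.+1.-tuple nat) : Prop :=
  exists m : nat,
    [/\ (j.+2 <= m)%N, class_C_near `[a, b] m c s,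
        tnth i ord0 = 1%N /\ sorted ltn i,
        (forall k, (tnth i k < m)%N)
      & wedge (deriv_rows s i) != 0].

Definition mildly_smoothly_turning : Prop :=
  forall s, a <= s <= b -> exists i, turning_indices s i.

(* "the smallest integers": each i_k is the smallest possible one *)
Definition smallest_turning_indices (s : R) (i : j.+1.-tuple nat) : Prop :=
  turning_indices s i /\
  forall i', turning_indices s i' -> forall k, (tnth i k <= tnth i' k)%N.

(* A union over the smallest indices, meaningful when these exist (they are
   then unique). *)
Definition osculating_space (s : R) : set 'rV[R]_n :=
  \bigcup_(i in smallest_turning_indices s)
    affine_span (c s) (deriv_rows s i).

End Osculating.

(* Main.v *)
Require Import Defs.
From HB Require Import structures.
From mathcomp Require Import all_boot all_order all_algebra.
From mathcomp Require Import all_classical all_reals all_analysis.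

Set Implicit Arguments.
Unset Strict Implicit.
Unset Printing Implicit Defensive.

Import Order.TTheory GRing.Theory Num.Theory.
Import numFieldNormedType.Exports.

Local Open Scope classical_set_scope.
Local Open Scope ring_scope.

(** The idea is to look at the derivatives of c near s in the frame that they
    span at s.  Let e_1, ..., e_(j+1) be the derivatives of orders
    i_1 < ... < i_(j+1) at s, for the smallest indices i, and let E be the matrix
    with these rows.

    _The smallest indices exist_ by a greedy choice: i_k is the first order l such
    that the derivatives of orders 1, ..., l span a space of dimension k.  This
    choice is minimal in every component, for any k independent derivatives span
    dimension k, and it comes with a flag property: every derivative of order
    l <= i_(j+1) is a combination of the e_q with i_q <= l
    ([minimal_free_rows]).

    _Near s the osculating space is a classical one._  Put h = t - s.  By the flag
    property the q-th coordinate x_q of c(t) in the frame satisfies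
    x_q^(l)(s) = 0 for 0 < l < i_q and x_q^(i_q)(s) = 1, so Taylor's formula
    gives h^k x_q^(k)(t) / h^(i_q) --> i_q (i_q - 1) ... (i_q - k + 1) / i_q!
    ([cvg_scaled_leading_term]).  For k = 1, ..., j+1 these limits form an
    invertible matrix, of Vandermonde type ([ffact_matrix_unit]).  The matrix
    X(t) of the coordinates of c'(t), ..., c^(j+1)(t) is this matrix up to the
    diagonal scalings by h^k and h^(i_q) and an error o(1), so it is invertible
    for t close to s and distinct from s.  Hence c', ..., c^(j+1) are independent
    at t, the smallest indices at t are 1, ..., j+1, and the osculating space at
    t has direction spanned by the rows W(t) of these derivatives.

    _Continuity._  The direction of the space at t is also spanned by the rows of
    X(t)^-1 W(t), and X(t)^-1 W(t) --> E ([frame_convergence]).  Indeed the part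
    of the derivatives transverse to the frame is o(h^(i_(j+1))) after scaling
    row k by h^k, which absorbs the inverses of all the h^(i_q).  The exterior product
    of the rows then converges to the one at s, which is nonzero, and so do the
    unit multivectors ([plane_dist_cvg0]).  The change of basis X(t)^-1 contains
    the choice of sign. *)

(** * Strictly increasing index tuples *)

Lemma tnth_sorted_lt j (i : j.+1.-tuple nat) (x y : 'I_j.+1) :
  sorted ltn i -> (x < y)%N -> (tnth i x < tnth i y)%N.
Proof.
move=> i_sorted xy; rewrite !(tnth_nth 0%N).
by apply: (sorted_ltn_nth ltn_trans) => //; rewrite inE size_tuple.
Qed.

Lemma tnth_sorted_ge j (i : j.+1.-tuple nat) (x : 'I_j.+1) :
  tnth i ord0 = 1%N -> sorted ltn i -> (x < tnth i x)%N.
Proof.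
move=> i1 i_sorted; case: x => x xj; elim: x xj => [|x IH] xj.
  by rewrite (_ : Ordinal xj = ord0) ?i1 //; apply: val_inj.
apply: leq_ltn_trans (IH (ltnW xj)) _.
by apply: tnth_sorted_lt => //=.
Qed.

Lemma tnth_sorted_max j (i : j.+1.-tuple nat) (x : 'I_j.+1) :
  sorted ltn i -> (tnth i x <= tnth i ord_max)%N.
Proof.
move=> i_sorted; have [-> //|x_max] := eqVneq x ord_max.
by apply/ltnW/tnth_sorted_lt; rewrite // ltn_neqAle x_max -ltnS /=.
Qed.

Lemma tnth_sorted_inj j (i : j.+1.-tuple nat) : sorted ltn i -> injective (tnth i).
Proof.
move=> i_sorted x y ixy; apply: val_inj.
case: (ltngtP (val x) (val y)) => // [xy|yx].
  by have := tnth_sorted_lt i_sorted xy; rewrite ixy ltnn.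
by have := tnth_sorted_lt i_sorted yx; rewrite ixy ltnn.
Qed.

(** * Exterior products of rows *)

Lemma wedge_mulmx (R : realType) (k n : nat) (A : 'M[R]_k) (v : 'M[R]_(k, n))
    (l : multiindex k n) :
  wedge (A *m v) l = \det A * wedge v l.
Proof.
rewrite !ffunE -det_mulmx; congr (\det _).
by apply/matrixP => i j; rewrite !mxE; apply: eq_bigr => x _; rewrite !mxE.
Qed.

(** Sorting the values of [f]; this passes from the arbitrary columns carrying a
    nonzero minor to the increasing ones that index coordinates of a multivector. *)
Lemma increasing_reindex (k n : nat) (f : 'I_k -> 'I_n) : injective f ->
  exists l : multiindex k n, forall x, exists y, f x = val l y.
Proof.
move=> f_inj; pose S := [set f x | x in 'I_k]%SET.
have cardS : #|S| = k by rewrite card_imset // card_ord.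
pose l := [ffun y : 'I_k => enum_val (cast_ord (esym cardS) y)].
have enum_sorted : sorted ltn [seq val z | z <- enum S].
  have -> : enum S = [seq z <- enum 'I_n | z \in S].
    by rewrite enumT.
  rewrite sorted_map sorted_filter //; first by move=> ? ? ?; apply: ltn_trans.
  by rewrite -sorted_map val_enum_ord iota_ltn_sorted.
have l_incr : [forall x : 'I_k, forall y : 'I_k, (x < y)%N ==> (l x < l y)%N].
  apply/forallP => x; apply/forallP => y; apply/implyP => xy.
  have nthE (z : 'I_k) : (l z = nth 0 [seq val z | z <- enum S] z :> nat)%N.
    have z_lt : (z < size (enum S))%N by rewrite -cardE cardS.
    by rewrite ffunE (enum_val_nth (f z)) (nth_map (f z)).
  rewrite !nthE.
  by apply: (sorted_ltn_nth ltn_trans); rewrite ?inE ?size_map -?cardE ?cardS.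
exists (exist _ l l_incr) => x.
have fxS : f x \in S by apply: imset_f.
exists (cast_ord cardS (enum_rank_in fxS (f x))).
by rewrite ffunE cast_ordK enum_rankK_in.
Qed.

(** A dependence between the rows restricts to every choice of columns, whence the
    vanishing of all minors; conversely a matrix of full row rank has k independent
    columns, which may be taken in increasing order. *)
Lemma wedge_neq0 (R : realType) (k n : nat) (v : 'M[R]_(k, n)) :
  (wedge v != 0) = row_free v.
Proof.
apply/idP/idP => [|v_free].
  apply: contra_neqT => v_dep; apply/ffunP => l; rewrite !ffunE.
  apply/eqP; apply: contraNT v_dep => det_neq0.
  have: row_free (colsub (val l) v) by rewrite row_free_unit unitmxE unitfE.
  rewrite -!kermx_eq0 => /eqP ker0; rewrite -submx0 -ker0; apply/sub_kermxP.
  move: (kermx v) (mulmx_ker v) => K /matrixP kv; apply/matrixP => i y.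
  move: (kv i (val l y)); rewrite !mxE => kiy; rewrite -[RHS]kiy.
  by apply: eq_bigr => z _; rewrite !mxE.
have full : row_full v^T by rewrite /row_full mxrank_tr.
have [l fl] := increasing_reindex (@fullrankfun_inj _ _ _ _ full).
apply/eqP => /ffunP /(_ l); rewrite !ffunE; apply/eqP.
rewrite -det_tr -unitfE -unitmxE -row_full_unit.
have -> : (colsub (val l) v)^T = rowsub (val l) v^T.
  by apply/matrixP => i z; rewrite !mxE.
(* The selected rows are among those of the increasing selection; comparing row
   spaces avoids the sign of the sorting permutation. *)
rewrite -sub1mx; apply: submx_trans (_ : (rowsub (fullrankfun full) v^T <= _)%MS).
  by rewrite sub1mx fullrowsub_full.
apply/row_subP => x; have [y fxl] := fl x.
rewrite row_rowsub fxl -row_rowsub.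
by apply: row_sub.
Qed.

(** * The greedy choice of independent vectors *)

Definition initial_span (F : fieldType) (n : nat) (v : nat -> 'rV[F]_n) (l : nat)
  : 'M[F]_n := (\sum_(x < l) <<v x.+1>>)%MS.

Section GreedyIndices.
Variables (F : fieldType) (n : nat) (v : nat -> 'rV[F]_n).
Local Notation spn := (initial_span v).
Local Notation rk l := (\rank (spn l)).

Lemma initial_spanS l : spn l.+1 = (spn l + <<v l.+1>>)%MS.
Proof. by rewrite /initial_span big_ord_recr. Qed.

Lemma initial_span_mono l l' : (l <= l')%N -> (spn l <= spn l')%MS.
Proof.
elim: l' => [|l' IH]; first by rewrite leqn0 => /eqP ->.
rewrite leq_eqVlt => /predU1P[->//|]; rewrite ltnS => /IH.
by move=> h; rewrite initial_spanS; apply: submx_trans h (addsmxSl _ _).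
Qed.

Lemma sub_initial_span l l' : (0 < l <= l')%N -> (v l <= spn l')%MS.
Proof.
case: l => // l /= ll'; apply: submx_trans (initial_span_mono ll').
by rewrite initial_spanS; apply: submx_trans (addsmxSr _ _); rewrite genmxE.
Qed.

Lemma rank_initial_spanS l : (rk l.+1 <= (rk l).+1)%N.
Proof.
rewrite initial_spanS (leq_trans (mxrank_adds_leqif _ _)) // -[(rk l).+1]addn1 leq_add2l.
by rewrite mxrank_gen rank_leq_row.
Qed.

(** The first q + 1 of the independent rows lie in the span of the vectors up to
    the (q+1)-st index.  The partial identity selects them while keeping the size
    of the matrix. *)
Lemma rank_initial_span_rows j (i : j.+1.-tuple nat) (q : 'I_j.+1) :
  (forall x, 0 < tnth i x)%N -> sorted ltn i ->
  row_free (\matrix_x v (tnth i x)) -> (q < rk (tnth i q))%N.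
Proof.
move=> i_gt0 i_sorted i_free.
rewrite -[X in (X <= _)%N](_ :
    \rank ((pid_mx q.+1 : 'M[F]_j.+1) *m (\matrix_x v (tnth i x))) = q.+1).
  apply/mxrankS/row_subP => x; rewrite row_mul.
  have [xq|qx] := leqP x q.
    have -> : row x (pid_mx q.+1) = delta_mx 0 x :> 'rV[F]_j.+1.
      by apply/rowP => y; rewrite !mxE ltnS xq andbT eq_sym.
    rewrite -rowE rowK sub_initial_span // i_gt0 /=.
    move: xq; rewrite leq_eqVlt => /predU1P[/val_inj-> //|xq].
    exact/ltnW/tnth_sorted_lt.
  have -> : row x (pid_mx q.+1) = 0 :> 'rV[F]_j.+1.
    by apply/rowP => y; rewrite !mxE ltnS leqNgt qx andbF.
  by rewrite mul0mx sub0mx.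
by rewrite mxrankMfree // rank_pid_mx.
Qed.

(** The greedy choice: the (q+1)-st index is the first one at which the dimension
    of the span of the initial vectors exceeds q.  As this dimension grows by at
    most one at each step, the chosen vectors span every initial span, which is
    the flag property in the last clause. *)
Lemma minimal_free_rows j (i0 : j.+1.-tuple nat) :
    tnth i0 ord0 = 1%N -> sorted ltn i0 ->
    row_free (\matrix_x v (tnth i0 x)) ->
  exists i : j.+1.-tuple nat,
  [/\ tnth i ord0 = 1%N /\ sorted ltn i,
      row_free (\matrix_x v (tnth i x)),
      (forall i' : j.+1.-tuple nat, tnth i' ord0 = 1%N -> sorted ltn i' ->
         row_free (\matrix_x v (tnth i' x)) ->
         forall x, (tnth i x <= tnth i' x)%N)
    & (forall l, (0 < l <= tnth i ord_max)%N ->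
         exists2 u : 'rV_j.+1, v l = u *m (\matrix_x v (tnth i x)) &
           forall x, (l < tnth i x)%N -> u 0 x = 0)].
Proof.
have gt0 (i : j.+1.-tuple nat) x : tnth i ord0 = 1%N -> sorted ltn i -> (0 < tnth i x)%N.
  by move=> i1 i_sorted; apply: leq_ltn_trans (tnth_sorted_ge x i1 i_sorted).
move=> i01 i0_sorted i0_free.
have lb (i : j.+1.-tuple nat) (i1 : tnth i ord0 = 1%N) (isrt : sorted ltn i)
    (ifree : row_free (\matrix_x v (tnth i x))) (q : 'I_j.+1) :
    (q < rk (tnth i q))%N.
  by apply: rank_initial_span_rows => // x; apply: gt0.
have exq (q : 'I_j.+1) : exists l, (q < rk l)%N by exists (tnth i0 q); apply: lb.
pose f q := ex_minn (exq q).
have f_rk (q : 'I_j.+1) : (q < rk (f q))%N by rewrite /f; case: ex_minnP.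
have f_min (q : 'I_j.+1) l : (q < rk l)%N -> (f q <= l)%N.
  by rewrite /f; case: ex_minnP => ? _; apply.
have rk0 : rk 0%N = 0%N by rewrite /initial_span big_ord0 mxrank0.
have f_gt0 q : (0 < f q)%N.
  by rewrite lt0n; apply: contraTneq (f_rk q) => ->; rewrite rk0.
have rk_f (q : 'I_j.+1) : rk (f q) = q.+1.
  apply/eqP; rewrite eqn_leq f_rk andbT -(prednK (f_gt0 q)).
  apply: leq_trans (rank_initial_spanS _) _; rewrite ltnS leqNgt.
  by apply/negP => /f_min; rewrite leqNgt prednK // leqnn.
have f_mono (x y : 'I_j.+1) : (x < y)%N -> (f x < f y)%N.
  move=> xy; rewrite ltnNge; apply/negP => /initial_span_mono/mxrankS.
  by rewrite !rk_f leqNgt ltnS xy.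
pose i := [tuple f x | x < j.+1].
have iE x : tnth i x = f x by rewrite tnth_mktuple.
have i1 : tnth i ord0 = 1%N.
  rewrite iE; apply/eqP; rewrite eqn_leq f_gt0 andbT; apply: f_min.
  by have := lb i0 i01 i0_sorted i0_free ord0; rewrite i01.
have i_sorted : sorted ltn i.
  apply/(sortedP 0%N) => x; rewrite size_tuple => xj.
  have := f_mono (Ordinal (ltnW xj)) (Ordinal xj) (ltnSn x).
  by rewrite -!iE !(tnth_nth 0%N).
have f_le_max x : (f x <= f ord_max)%N by rewrite -!iE; exact: tnth_sorted_max.
(* Zeroing the rows of index larger than l, rather than deleting them, keeps
   matrices of a fixed size. *)
pose E l := \matrix_x (if (f x <= l)%N then v (f x) else 0).
have E_mono l l' : (l <= l')%N -> (E l <= E l')%MS.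
  move=> ll'; apply/row_subP => x; rewrite rowK; case: ifP => [fx|_]; last exact: sub0mx.
  by rewrite (_ : v _ = row x (E l')) ?row_sub // rowK (leq_trans fx ll').
have spn_E l : (l <= f ord_max)%N -> (spn l <= E l)%MS.
  elim: l => [_|l IH lp]; first by rewrite /initial_span big_ord0 sub0mx.
  have spnl : (spn l <= E l.+1)%MS.
    by apply: submx_trans (IH (ltnW lp)) (E_mono _ _ (leqnSn l)).
  rewrite initial_spanS addsmx_sub spnl genmxE /=.
  have [rk_lt|rk_le] := ltnP (rk l) (rk l.+1).
    have l_max : (rk l < j.+1)%N.
      rewrite -[j.+1](rk_f ord_max); apply: leq_trans rk_lt _.
      exact/mxrankS/initial_span_mono.
    pose q := Ordinal l_max.
    have fq : f q = l.+1.
      apply/eqP; rewrite eqn_leq f_min //= ltnNge.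
      by apply/negP => /initial_span_mono/mxrankS; rewrite rk_f /= ltnn.
    by rewrite (_ : v _ = row q (E l.+1)) ?row_sub // rowK fq leqnn.
  apply: submx_trans spnl.
  have -> : (v l.+1 <= spn l)%MS = (spn l.+1 <= spn l)%MS.
    by rewrite initial_spanS addsmx_sub submx_refl genmxE.
  by rewrite -(geq_leqif (mxrank_leqif_sup (initial_span_mono (leqnSn l)))).
have EE : E (f ord_max) = \matrix_x v (tnth i x).
  by apply/row_matrixP => x; rewrite !rowK f_le_max iE.
exists i; split=> //.
- rewrite /row_free eqn_leq rank_leq_row /= -EE -[X in (X <= _)%N](rk_f ord_max).
  exact/mxrankS/spn_E.
- by move=> i' i'1 i'_sorted i'_free x; rewrite iE; apply/f_min/lb.
move=> l; rewrite iE => /andP[l_gt0 lp].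
have /submxP[u vu] : (v l <= E l)%MS.
  by apply: submx_trans (spn_E l lp); apply: sub_initial_span; rewrite l_gt0 /=.
exists (\row_x (if (f x <= l)%N then u 0 x else 0)) => [|x]; last first.
  by rewrite iE mxE ltnNge => /negbTE ->.
rewrite vu; apply/rowP => y; rewrite !mxE; apply: eq_bigr => x _; rewrite !mxE iE.
by case: ifP => _; rewrite ?mxE ?mulr0 ?mul0r.
Qed.
End GreedyIndices.

(** * A Vandermonde matrix of falling factorials *)

Section FallingFactorials.
Variables (R : realType).

Fixpoint ffact_poly (k : nat) : {poly R} :=
  if k is k'.+1 then ffact_poly k' * ('X - k'%:R%:P) else 1.

Lemma size_ffact_poly k : size (ffact_poly k) = k.+1.
Proof.
elim: k => [|k IH] /=; first by rewrite size_poly1.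
rewrite size_mul ?polyXsubC_eq0 -?size_poly_eq0 ?IH // size_XsubC.
by rewrite addn2.
Qed.

Lemma horner_ffact_poly k x : (ffact_poly k).[x%:R] = (x ^_ k)%:R.
Proof.
elim: k => [|k IH]; first by rewrite hornerE.
rewrite /= hornerM IH hornerXsubC ffactnSr natrM.
have [kx|xk] := leqP k x; first by rewrite natrB.
by rewrite ffact_small // !mul0r.
Qed.

(** A dependence between the rows is a combination of the falling factorials of
    degrees 1, ..., n that vanishes at the n values [i x] and also at 0, hence
    identically; its coefficients are then found to be zero one after the other. *)
Lemma ffact_matrix_unit n (i : 'I_n -> nat) :
  (forall x, (0 < i x)%N) -> injective i ->
  \matrix_(k < n, x < n) (((i x) ^_ k.+1)%:R : R) \in unitmx.
Proof.
move=> i_gt0 i_inj; rewrite -row_free_unit; apply: inj_row_free => u uC0.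
pose P := \sum_(k < n) u 0 k *: ffact_poly k.+1.
have P_at x : P.[x%:R] = \sum_(k < n) u 0 k * (x ^_ k.+1)%:R.
  by rewrite horner_sum; apply: eq_bigr => k _; rewrite hornerZ horner_ffact_poly.
have P0 : P = 0.
  have P_root x : \sum_(k < n) u 0 k * (x ^_ k.+1)%:R = 0 -> root P x%:R.
    by move=> Px0; rewrite /root P_at Px0.
  pose xs := 0%N :: [seq i x | x <- enum 'I_n].
  apply: (@roots_geq_poly_eq0 _ P [seq x%:R | x <- xs]).
  - apply/allP => _ /mapP[x + ->]; rewrite inE => x_xs; apply: P_root.
    case/predU1P: x_xs => [->|/mapP[y _ ->]].
      by rewrite big1 // => k _; rewrite ffact_small ?mulr0.
    move/rowP: uC0 => /(_ y); rewrite !mxE => uC0; rewrite -[RHS]uC0.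
    by apply: eq_bigr => k _; rewrite mxE.
  - rewrite map_inj_uniq => [|x y /eqP]; last by rewrite eqr_nat => /eqP.
    rewrite /= map_inj_uniq ?enum_uniq ?andbT //.
    by apply/mapP => -[x _ ix]; have := i_gt0 x; rewrite -ix.
  rewrite size_map /= size_map size_enum_ord; apply: (leq_trans (size_sum _ _ _)).
  apply/bigmax_leqP => k _.
  by apply: leq_trans (size_scale_leq _ _) _; rewrite size_ffact_poly ltnS.
suff u0 m : forall k : 'I_n, (k < m)%N -> u 0 k = 0.
  by apply/rowP => k; rewrite mxE (u0 k.+1).
elim: m => // m IH k; rewrite ltnS leq_eqVlt => /predU1P[km|]; last exact: IH.
(* At k + 1 the falling factorials of higher degree vanish, and those of lower
   degree have zero coefficient by induction. *)
have := P_at k.+1; rewrite P0 horner0 (bigD1 k) //= big1 => [|l lk].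
  rewrite addr0 => /eqP; rewrite eq_sym mulf_eq0 => /orP[/eqP //|].
  by rewrite pnatr_eq0 ffactnn gtn_eqF ?fact_gt0.
have [lt_lk|] := ltnP l k; first by rewrite IH ?mul0r // -km.
rewrite leq_eqVlt eq_sym => /predU1P[/val_inj/eqP|kl]; first by rewrite (negbTE lk).
by rewrite ffact_small ?mulr0.
Qed.

End FallingFactorials.

(** * Leading terms of Taylor expansions *)

Section LeadingTerm.
Variables (R : realType).

Lemma is_derive_shift_pow (s t : R) d :
  is_derive t (1 : R) (fun x => (x - s) ^+ d.+1) (d.+1%:R * (t - s) ^+ d).
Proof.
have h : is_derive t (1 : R) (fun x : R => x - s) 1.
  by apply: is_derive_eq; rewrite subr0.
have := is_deriveX d.+1 h; rewrite /= => {}h.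
rewrite exprfctE in h.
by apply: is_derive_eq; exact: mulr1.
Qed.

(** Taylor's formula for a function whose derivatives below the order [k + d]
    vanish, by iterating l'Hopital's rule. *)
Lemma cvg_leading_term (g : nat -> R -> R) (s : R) (d k : nat) :
  (forall l, (k <= l < k + d)%N ->
     \forall t \near s, is_derive (t : R) (1 : R) (g l) (g l.+1 t)) ->
  {for s, continuous (g (k + d)%N)} ->
  (forall l, (k <= l < k + d)%N -> g l s = 0) ->
  g k t / (t - s) ^+ d @[t --> s^'] --> g (k + d)%N s / d`!%:R.
Proof.
elim: d k => [|d IH] k g_derive g_cont g_zero.
  rewrite addn0 in g_cont *; rewrite divr1; under eq_fun do rewrite divr1.
  exact: cvg_within_filter.
have kd : (k <= k < k + d.+1)%N by rewrite leqnn -addn1 leq_add2l.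
have := IH k.+1; rewrite addSnnS => {}IH.
have {}IH : g k.+1 t / (t - s) ^+ d @[t --> s^'] --> g (k + d.+1)%N s / d`!%:R.
  by apply: IH => // l /andP[kl ld]; [apply: g_derive | apply: g_zero];
    rewrite (ltnW kl).
have [e /= e_gt0 g_ball] :
    nbhs_ball s [set t : R | is_derive (t : R) (1 : R) (g k) (g k.+1 t)].
  by rewrite nbhs_ballE; apply: g_derive.
pose L := g (k + d.+1)%N s / d.+1`!%:R.
(* The quotient of the derivatives is completed by its limit at s, where it would
   otherwise be 0 / 0, because the rule asks for a full limit. *)
pose df t := if t == s then L else g k.+1 t.
pose dh t := if t == s then 1 else d.+1%:R * (t - s) ^+ d.
have near_itv t : t \in `]s - e, s + e[ -> ball s e t.
  by rewrite in_itv /= -ball_normE /= distrC ltr_distl.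
have s_itv : s \in `]s - e, s + e[ by rewrite in_itv /= ltrDl ltrBlDr ltrDl e_gt0.
apply: (@lhopital R _ df _ dh (s - e) (s + e)) => //.
- move=> t; rewrite inE => -[/= t_itv /eqP/negbTE ts]; rewrite /df ts.
  exact/g_ball/near_itv.
- move=> t; rewrite inE => -[/= t_itv /eqP/negbTE ts]; rewrite /dh ts.
  exact: is_derive_shift_pow.
- rewrite -(g_zero k kd).
  have [gs _] := g_ball s (near_itv s s_itv).
  by apply: differentiable_continuous; apply/derivable1_diffP.
- have [hs _] := is_derive_shift_pow s s d.
  have hcont : {for s, continuous (fun x : R => (x - s) ^+ d.+1)}.
    by apply: differentiable_continuous; apply/derivable1_diffP.
  rewrite [X in _ --> X](_ : 0 = (s - s) ^+ d.+1); first exact: hcont.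
  by rewrite subrr expr0n.
- move=> t; rewrite inE => -[/= t_itv /eqP/negbTE ts]; rewrite /dh ts.
  by rewrite mulf_neq0 ?pnatr_eq0 // expf_neq0 // subr_eq0 ts.
rewrite -/L; have Lds : L = df s / dh s by rewrite /df /dh eqxx divr1.
suff: {for s, continuous (fun t => df t / dh t)} by rewrite Lds.
apply/continuous_withinNx; rewrite -Lds.
have -> : L = g (k + d.+1)%N s / d`!%:R / d.+1%:R.
  by rewrite /L factS natrM invfM [X in _ * X]mulrC mulrA.
have dcst : cst (d.+1%:R^-1 : R) t @[t --> s^'] --> (d.+1%:R^-1 : R) by exact: cvg_cst.
have IHd : g k.+1 t / (t - s) ^+ d * d.+1%:R^-1 @[t --> s^']
    --> g (k + d.+1)%N s / d`!%:R * d.+1%:R^-1 by exact: cvgM IH dcst.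
apply: (cvg_trans (near_eq_cvg _) IHd); near=> t.
have ts : t == s = false by apply/negbTE; near: t; exact: nbhs_dnbhs_neq.
by rewrite /df /dh ts /= invfM mulrA mulrAC.
Unshelve. all: by end_near. Qed.

Lemma cvg_shift_pow (s : R) d : (t - s) ^+ d @[t --> s] --> (0 ^+ d : R).
Proof.
elim: d => [|d IH]; first by under eq_fun do rewrite expr0; exact: cvg_cst.
rewrite exprS; under eq_fun do rewrite exprS.
apply: cvgM => //; rewrite -[X in _ --> X](subrr s).
by apply: cvgB; [exact: cvg_id | exact: cvg_cst].
Qed.

(** Multiplying by [(t - s) ^+ k] turns the two cases k <= r and k > r into a single
    formula: in the second one the falling factorial vanishes, and so does the
    limit. *)
Lemma cvg_scaled_leading_term (g : nat -> R -> R) (s : R) (m k r : nat) :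
    (forall l, (l < m)%N ->
       \forall t \near s, is_derive (t : R) (1 : R) (g l) (g l.+1 t)) ->
    (forall l, (l <= m)%N -> {for s, continuous (g l)}) ->
    (0 < k <= m)%N -> (r <= m)%N -> (forall l, (0 < l < r)%N -> g l s = 0) ->
  (t - s) ^+ k * g k t / (t - s) ^+ r @[t --> s^'] --> (r ^_ k)%:R / r`!%:R * g r s.
Proof.
move=> g_derive g_cont /andP[k_gt0 km] rm g_zero.
have [kr|rk] := leqP k r.
  have := @cvg_leading_term g s (r - k) k; rewrite subnKC // => lead.
  have {}lead : g k t / (t - s) ^+ (r - k) @[t --> s^'] --> g r s / (r - k)`!%:R.
    apply: lead => [l /andP[kl lr]||l /andP[kl lr]].
    - exact/g_derive/(leq_trans lr).
    - exact: g_cont.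
    - by apply: g_zero; rewrite lr (leq_trans k_gt0).
  have -> : (r ^_ k)%:R / r`!%:R * g r s = g r s / (r - k)`!%:R.
    have factE : r`!%:R = (r ^_ k)%:R * (r - k)`!%:R :> R by rewrite -natrM ffact_fact.
    rewrite factE invfM mulrA divff ?mul1r; first exact: mulrC.
    by rewrite pnatr_eq0 -lt0n ffact_gt0.
  apply: (cvg_trans (near_eq_cvg _) lead); near=> t.
  have ts : t - s != 0 by rewrite subr_eq0; near: t; exact: nbhs_dnbhs_neq.
  have -> : (t - s) ^+ r = (t - s) ^+ k * (t - s) ^+ (r - k) by rewrite -exprD subnKC.
  by rewrite invfM mulrACA mulfV ?expf_neq0 // mul1r.
rewrite ffact_small // !mul0r.
have lim0 : (t - s) ^+ (k - r) * g k t @[t --> s^'] --> (0 : R).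
  rewrite [X in _ --> X](_ : 0 = 0 ^+ (k - r) * g k s).
    by apply: cvg_within_filter; apply: cvgM; [exact: cvg_shift_pow | exact: g_cont].
  by rewrite expr0n subn_eq0 leqNgt rk mul0r.
apply: (cvg_trans (near_eq_cvg _) lim0); near=> t.
have ts : t - s != 0 by rewrite subr_eq0; near: t; exact: nbhs_dnbhs_neq.
have -> : (t - s) ^+ k = (t - s) ^+ (k - r) * (t - s) ^+ r.
  by rewrite -exprD subnK // ltnW.
by rewrite mulrAC mulfK ?expf_neq0.
Unshelve. all: by end_near. Qed.

End LeadingTerm.

(** * Scalar components of a curve *)

Section Components.
Variables (R : realType) (n : nat).
Implicit Types (f : R -> 'rV[R]_n) (u : 'cV[R]_n).

Definition component u f (t : R) : R := (f t *m u) 0 0.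

Lemma cvg_component (G : set_system R) (FG : Filter G) f (l : 'rV[R]_n) u :
  f x @[x --> G] --> l -> component u f x @[x --> G] --> (l *m u) 0 0.
Proof.
move=> fl; rewrite /component mxE; under eq_fun do rewrite mxE.
apply: cvg_big => [|i _]; first exact: add_continuous.
apply: cvgM; last exact: cvg_cst.
exact: cvg_comp fl (@coord_continuous _ _ _ _ _ _).
Qed.

Lemma component_col k (B : 'M[R]_(n, k)) q f t :
  component (col q B) f t = (f t *m B) 0 q.
Proof. by rewrite /component !mxE; apply: eq_bigr => l _; rewrite !mxE. Qed.

Lemma within_itv_interior (a b t : R) : a < t < b -> `[a, b]^° t.
Proof.
by move=> abt; rewrite interior_itv_bnd /= in_itv. Qed.

(** Near an interior point the restriction to [a, b] is void, so the derivative
    inside [a, b] is the usual one, up to reindexing the difference quotient by the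
    increment; taking a component is linear and continuous. *)
Lemma is_derive_component (a b t : R) f u : a < t < b ->
  derivable_on `[a, b] f t ->
  is_derive t (1 : R) (component u f) (component u (deriv_on `[a, b] f) t).
Proof.
move=> abt; rewrite /derivable_on => fdrv.
have tN : within `[a, b] t^' = t^'.
  have tE := within_interior (within_itv_interior abt).
  apply/funext => P; apply/propext; split=> tP.
    change (nbhs t [set x | x != t -> P x]); rewrite -tE.
    change (nbhs t [set x | `[a, b]%classic x -> x != t -> P x]).
    apply: (@filterS _ (nbhs t) _ _ _ _ tP) => x xP ax xt; exact: xP.
  change (nbhs t [set x | x != t -> `[a, b]%classic x -> P x]).
  apply: (@filterS _ (nbhs t) _ _ _ _ tP) => x xP xt ax; exact: xP.
have dq : diff_quotient f t x @[x --> t^'] --> deriv_on `[a, b] f t.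
  by move: fdrv; rewrite /deriv_on tN.
have shift_cvg : h + t @[h --> 0^'] --> t^'.
  have shift_cont : {for 0, continuous (fun h : R => h + t)}.
    by apply: cvgD; [exact: cvg_id | exact: cvg_cst].
  have := continuous_injective_withinNx shift_cont; rewrite add0r; apply=> y.
  by move=> /(canRL (addrK t)); rewrite subrr.
have lim_dq :
    h^-1 *: ((component u f \o shift t) (h *: 1) - component u f t) @[h --> 0^']
    --> component u (deriv_on `[a, b] f) t.
  have dq_shift : component u (fun h => diff_quotient f t (h + t)) h @[h --> 0^']
      --> component u (deriv_on `[a, b] f) t.
    by apply: cvg_component; exact: cvg_comp shift_cvg dq.
  apply: (cvg_trans (near_eq_cvg _) dq_shift); near=> h.
  rewrite /component /= /diff_quotient addrK -scalemxAl mxE mulmxBl !mxE.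
  by rewrite [h *: 1]mulr1.
split; first by apply: cvgP lim_dq.
exact: cvg_lim lim_dq.
Unshelve. all: by end_near. Qed.

Lemma class_C_component (a b s : R) m f u : a < s < b ->
  class_C_near `[a, b] m f s ->
  (forall k, (k < m)%N -> \forall t \near s, is_derive (t : R) (1 : R)
     (component u (derivn_on `[a, b] k f))
     (component u (derivn_on `[a, b] k.+1 f) t)) /\
  (forall k, (k <= m)%N -> {for s, continuous (component u (derivn_on `[a, b] k f))}).
Proof.
move=> abs; rewrite /class_C_near (within_interior (within_itv_interior abs)) => Cm.
pose g k := component u (derivn_on `[a, b] k f).
have g_derive k : (k < m)%N ->
    \forall t \near s, is_derive (t : R) (1 : R) (g k) (g k.+1 t).
  move=> km; near=> t; apply: is_derive_component.
    have : `]a, b[%classic t by near: t; apply: near_in_itvoo; rewrite in_itv.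
    by rewrite /= in_itv.
  have [+ _] : (forall k, (k < m)%N -> derivable_on `[a, b] (derivn_on `[a, b] k f) t) /\
      derivn_on `[a, b] m f x @[x --> within `[a, b] (nbhs t)] --> derivn_on `[a, b] m f t.
    by near: t; exact: Cm.
  exact.
split=> // k; rewrite leq_eqVlt => /predU1P[->|km]; last first.
  have [gk _] := nbhs_singleton (g_derive _ km).
  by apply: differentiable_continuous; apply/derivable1_diffP.
have [_] := nbhs_singleton Cm; rewrite (within_interior (within_itv_interior abs)) => fm.
exact: cvg_component.
Unshelve. all: by end_near. Qed.

End Components.

(** * Limits of determinants and inverse matrices *)

Section MatrixLimits.
Variables (R : realType).

Lemma cvg_det (T : Type) (G : set_system T) (FG : Filter G) k
    (A : T -> 'M[R]_k) (L : 'M[R]_k) :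
  (forall x y, A t x y @[t --> G] --> L x y) -> \det (A t) @[t --> G] --> \det L.
Proof.
move=> AL; rewrite /determinant; apply: cvg_big => [|s _]; first exact: add_continuous.
apply: cvgM; first exact: cvg_cst.
by apply: cvg_big => [|x _]; [exact: mul_continuous|exact: AL].
Qed.

Lemma cvg_invmx (T : Type) (G : set_system T) (FG : Filter G) k
    (A : T -> 'M[R]_k) (L : 'M[R]_k) : L \in unitmx ->
  (forall x y, A t x y @[t --> G] --> L x y) ->
  forall x y, invmx (A t) x y @[t --> G] --> invmx L x y.
Proof.
move=> L_unit AL x y.
have detAL : \det (A t) @[t --> G] --> \det L by exact: cvg_det.
have detL : \det L != 0 by rewrite -unitfE -unitmxE.
have detA : \forall t \near G, \det (A t) != 0 by exact: cvgr_neq0 detAL detL.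
have adjAL : (\adj (A t)) x y @[t --> G] --> (\adj L) x y.
  rewrite mxE; under eq_fun do rewrite mxE.
  apply: cvgM; first exact: cvg_cst.
  apply: cvg_det => p q; rewrite !mxE; under eq_fun do rewrite !mxE.
  exact: AL.
have -> : invmx L x y = (\det L)^-1 * (\adj L) x y by rewrite /invmx L_unit mxE.
have lim_prod : (\det (A t))^-1 * (\adj (A t)) x y @[t --> G]
    --> (\det L)^-1 * (\adj L) x y by apply: cvgM => //; apply: cvgV.
apply: (cvg_trans (near_eq_cvg _) lim_prod); near=> t.
rewrite /invmx unitmxE unitfE ifT ?mxE //.
by near: t.
Unshelve. all: by end_near. Qed.

End MatrixLimits.

(** * Convergence of planes *)

Section PlaneConvergence.
Variables (R : realType).

Lemma cvg_kvector_norm (T : Type) (G : set_system T) (FG : Filter G) k n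
    (w : T -> kvector k n) (w0 : @kvector R k n) :
  (forall l, w t l @[t --> G] --> w0 l) ->
  kvector_norm (w t) @[t --> G] --> kvector_norm w0.
Proof.
move=> ww0.
have sum_cvg : \sum_l w t l ^+ 2 @[t --> G] --> \sum_l w0 l ^+ 2.
  apply: cvg_big => [|l _]; first exact: add_continuous.
  by rewrite expr2; under eq_fun do rewrite expr2; apply: cvgM; apply: ww0.
exact: cvg_comp sum_cvg (@sqrt_continuous R _).
Qed.

Lemma kvector_norm_eq0 k n (w : @kvector R k n) : (kvector_norm w == 0) = (w == 0).
Proof.
have sum_ge0 : 0 <= \sum_l w l ^+ 2 by apply: sumr_ge0 => l _; exact: sqr_ge0.
rewrite /kvector_norm sqrtr_eq0 le_eqVlt ltNge sum_ge0 orbF.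
rewrite psumr_eq0 => [|l _]; last exact: sqr_ge0.
apply/allP/eqP => [w0|-> l _]; last by rewrite ffunE expr0n /= eqxx.
apply/ffunP => l; rewrite ffunE; apply/eqP; rewrite -sqrf_eq0.
exact: w0 (mem_index_enum l).
Qed.

Lemma fun_of_kvectorB k n (w w' : @kvector R k n) l : (w - w') l = w l - w' l.
Proof. by rewrite !ffunE. Qed.

Lemma kvector_norm0 k n : kvector_norm (0 : @kvector R k n) = 0.
Proof. by apply/eqP; rewrite kvector_norm_eq0. Qed.

Lemma kvector_normZ k n a (w w' : @kvector R k n) :
  (forall l, w' l = a * w l) -> kvector_norm w' = `|a| * kvector_norm w.
Proof.
move=> w'E; rewrite /kvector_norm -sqrtr_sqr -sqrtrM ?sqr_ge0 // mulr_sumr.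
by congr Num.sqrt; apply: eq_bigr => l _; rewrite w'E exprMn.
Qed.

Definition unit_wedge k n (v : 'M[R]_(k, n)) : kvector k n :=
  [ffun l => (kvector_norm (wedge v))^-1 * wedge v l].

Lemma affine_span_unit k n x (A : 'M[R]_k) (v : 'M[R]_(k, n)) :
  A \in unitmx -> affine_span x (A *m v) = affine_span x v.
Proof.
move=> Au; apply/seteqP; split=> y /=; rewrite /affine_span /=.
  by move=> /submx_trans; apply; apply: submxMl.
by move=> /submx_trans; apply; apply/submxP; exists (invmx A); rewrite mulKmx.
Qed.

(** Dividing one row by the norm of the exterior product divides the product by
    it, and does not change the span. *)
Lemma orients_unit_wedge k n x (v : 'M[R]_(k.+1, n)) :
  row_free v -> orients (affine_span x v) (unit_wedge v).
Proof.
rewrite -wedge_neq0 -kvector_norm_eq0 => w0; split.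
  rewrite (@kvector_normZ _ _ (kvector_norm (wedge v))^-1 (wedge v)) => [|l].
    by rewrite ger0_norm ?mulVf // invr_ge0 sqrtr_ge0.
  by rewrite ffunE.
pose d : 'rV[R]_k.+1 := \row_x (if x == 0 then (kvector_norm (wedge v))^-1 else 1).
have detd : \det (diag_mx d) = (kvector_norm (wedge v))^-1.
  rewrite det_diag big_ord_recl mxE eqxx big1 ?mulr1 // => y _.
  by rewrite mxE.
exists x, (diag_mx d *m v); split; last first.
  by apply/ffunP => l; rewrite wedge_mulmx detd ffunE.
by rewrite affine_span_unit // unitmxE unitfE detd invr_eq0.
Qed.

Lemma plane_dist_ge0 k n (P Q : set 'rV[R]_n) : (0 <= plane_dist k P Q)%E.
Proof.
by apply: le_ereal_inf_tmp => _ [v _ [w _ <-]]; rewrite lee_fin sqrtr_ge0.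
Qed.

(** Convergent bases of the directions orient the planes by unit multivectors that
    converge too, because normalization is continuous away from zero. *)
Lemma plane_dist_cvg0 k n (s : R) (x : R -> 'rV[R]_n) (M : R -> 'M[R]_(k.+1, n)) :
  row_free (M s) -> (forall p q, M t p q @[t --> s] --> M s p q) ->
  plane_dist k.+1 (affine_span (x t) (M t)) (affine_span (x s) (M s))
    @[t --> s] --> 0%E.
Proof.
move=> Ms_free Mcvg.
have wedge_cvg l : wedge (M t) l @[t --> s] --> wedge (M s) l.
  rewrite ffunE; under eq_fun do rewrite ffunE.
  apply: cvg_det => p q; rewrite mxE; under eq_fun do rewrite mxE.
  exact: Mcvg.
have norm_cvg : kvector_norm (wedge (M t)) @[t --> s] --> kvector_norm (wedge (M s)).
  exact: cvg_kvector_norm.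
have norm_neq0 : kvector_norm (wedge (M s)) != 0.
  by rewrite kvector_norm_eq0 wedge_neq0.
have unit_cvg l : unit_wedge (M t) l @[t --> s] --> unit_wedge (M s) l.
  rewrite ffunE; under eq_fun do rewrite ffunE.
  by apply: cvgM => //; apply: cvgV.
have free_near : \forall t \near s, row_free (M t).
  near=> t; rewrite -wedge_neq0 -kvector_norm_eq0.
  near: t; apply: (cvgr_neq0 _ norm_cvg); exact: norm_neq0.
have dist_cvg :
    (kvector_norm (unit_wedge (M t) - unit_wedge (M s)))%:E @[t --> s] --> 0%E.
  apply: cvg_EFin; first exact: nearW.
  rewrite -[X in _ --> X](kvector_norm0 k.+1 n); apply: cvg_kvector_norm => l.
  under eq_fun do rewrite fun_of_kvectorB.
  have cst_cvg : unit_wedge (M s) l @[_ --> s] --> unit_wedge (M s) l by exact: cvg_cst.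
  have -> : (0 : @kvector R k.+1 n) l = 0 by rewrite ffunE.
  have : unit_wedge (M t) l - unit_wedge (M s) l @[t --> s] -->
      unit_wedge (M s) l - unit_wedge (M s) l by apply: cvgB; first exact: unit_cvg.
  by rewrite subrr.
apply: (squeeze_cvge _ (cvg_cst _) dist_cvg).
near=> t; rewrite plane_dist_ge0 /=; apply: ereal_inf_lbound.
exists (unit_wedge (M t)); first by apply: orients_unit_wedge; near: t.
by exists (unit_wedge (M s)) => //; apply: orients_unit_wedge.
Unshelve. all: by end_near. Qed.

End PlaneConvergence.

(** * The moving frame near a point *)

Section OsculatingFrame.
Variables (R : realType).

(** Expressing the inverse through the rescaled matrix [K *m X *m D], which has an
    invertible limit when X itself degenerates. *)
Lemma invmx_factor k (K X D : 'M[R]_k) : K *m X *m D \in unitmx ->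
  invmx X = D *m invmx (K *m X *m D) *m K.
Proof.
move=> KXD_unit.
have XDK : X *m (D *m invmx (K *m X *m D) *m K) = 1%:M.
  by rewrite !mulmxA; apply: mulmx1C; rewrite !mulmxA mulmxV.
by rewrite -[LHS]mulmx1 -[in LHS]XDK mulKmx //; case: (mulmx1_unit XDK).
Qed.

(** The rows of [W t] are the first j + 1 derivatives, and the pseudo-inverse of E
    gives the coordinates in the frame E together with a projection onto its span.
    The hypothesis on the vectors [f l s] is the flag property of the smallest
    indices. *)
Lemma frame_convergence n j m (f : nat -> R -> 'rV[R]_n) (s : R)
    (i : j.+1.-tuple nat) (E : 'M[R]_(j.+1, n)) (W : R -> 'M[R]_(j.+1, n)) :
    (forall u k, (k < m)%N -> \forall t \near s,
       is_derive (t : R) (1 : R) (component u (f k)) (component u (f k.+1) t)) ->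
    (forall u k, (k <= m)%N -> {for s, continuous (component u (f k))}) ->
    (forall x, 0 < tnth i x < m)%N -> sorted ltn i -> (j.+1 < m)%N ->
    (forall x, row x E = f (tnth i x) s) -> row_free E ->
    (forall l, (0 < l <= tnth i ord_max)%N ->
       exists2 u : 'rV_j.+1, f l s = u *m E & forall x, (l < tnth i x)%N -> u 0 x = 0) ->
    (forall t k, row k (W t) = f k.+1 t) ->
  (\forall t \near s^', W t *m pinvmx E \in unitmx) /\
  forall p q, (invmx (W t *m pinvmx E) *m W t) p q @[t --> s^'] --> E p q.
Proof.
move=> f_derive f_cont i_range i_sorted jm E_row E_free flag W_row.
have i_inj := tnth_sorted_inj i_sorted.
have i_max x := tnth_sorted_max x i_sorted.
pose X t := W t *m pinvmx E.
set r := tnth i ord_max in i_max flag.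
have EB : E *m pinvmx E = 1%:M by exact: mulmxVp.
pose C : 'M[R]_j.+1 := \matrix_(k, q) ((tnth i q ^_ k.+1)%:R / (tnth i q)`!%:R).
have C_unit : C \in unitmx.
  have -> : C = (\matrix_(k, q) ((tnth i q ^_ k.+1)%:R : R)) *m
      diag_mx (\row_q ((tnth i q)`!%:R : R)^-1).
    by apply/matrixP => k q; rewrite mul_mx_diag !mxE.
  rewrite unitmx_mul ffact_matrix_unit //=; last by move=> x; case/andP: (i_range x).
  rewrite unitmxE det_diag unitfE; apply/prodf_neq0 => q _.
  by rewrite mxE invr_eq0 pnatr_eq0 -lt0n fact_gt0.
(* The coordinates, with the power of t - s that governs them divided out. *)
pose G t : 'M[R]_j.+1 :=
  \matrix_(k, q) ((t - s) ^+ k.+1 * X t k q / (t - s) ^+ tnth i q).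
have k_range (k : 'I_j.+1) : (0 < k.+1 <= m)%N.
  by rewrite /= (leq_trans (ltn_ord k)) // ltnW.
have rowsE k B (q : 'I_k) x t : (W t *m B) x q = component (col q B) (f x.+1) t.
  by rewrite component_col -W_row -row_mul [RHS]mxE.
have f_at_i q : f (tnth i q) s = delta_mx 0 q *m E by rewrite -E_row rowE.
have G_cvg k q : G t k q @[t --> s^'] --> C k q.
  have -> : C k q = (tnth i q ^_ k.+1)%:R / (tnth i q)`!%:R *
      component (col q (pinvmx E)) (f (tnth i q)) s.
    by rewrite component_col f_at_i -mulmxA EB mulmx1 !mxE !eqxx mulr1.
  under eq_fun do rewrite mxE rowsE.
  apply: (@cvg_scaled_leading_term R
    (fun l => component (col q (pinvmx E)) (f l)) s m).
  - by move=> l; apply: f_derive.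
  - by move=> l; apply: f_cont.
  - exact: k_range.
  - by case/andP: (i_range q) => _ /ltnW.
  move=> l /andP[l_gt0 lq]; rewrite component_col.
  have [|u -> u0] := flag l; first by rewrite l_gt0 (leq_trans (ltnW lq)).
  by rewrite -mulmxA EB mulmx1 u0.
(* The part of the derivatives transverse to the frame. *)
pose Q t : 'M[R]_(j.+1, n) := W t *m (1%:M - pinvmx E *m E).
have Q_cvg (k : 'I_j.+1) y :
    (t - s) ^+ k.+1 * Q t k y / (t - s) ^+ r @[t --> s^'] --> (0 : R).
  have f_zero l : (0 < l <= r)%N ->
      component (col y (1%:M - pinvmx E *m E)) (f l) s = 0.
    move=> /flag[u fu _]; rewrite component_col fu mulmxBr mulmx1 -mulmxA.
    by rewrite [E *m _]mulmxA EB mul1mx subrr mxE.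
  have r_range := i_range ord_max.
  rewrite [X in _ --> X](_ : 0 = (r ^_ k.+1)%:R / r`!%:R *
      component (col y (1%:M - pinvmx E *m E)) (f r) s); last first.
    by rewrite f_zero ?mulr0 // leqnn andbT; case/andP: r_range.
  under eq_fun do rewrite rowsE.
  apply: (@cvg_scaled_leading_term R
    (fun l => component (col y (1%:M - pinvmx E *m E)) (f l)) s m).
  - by move=> l; apply: f_derive.
  - by move=> l; apply: f_cont.
  - exact: k_range.
  - by case/andP: r_range => _ /ltnW.
  by move=> l /andP[l_gt0 lr]; apply: f_zero; rewrite l_gt0 ltnW.
have detC : \det C != 0 by rewrite -unitfE -unitmxE.
have near_neq : \forall t \near s^', t - s != 0.
  by near=> t; rewrite subr_eq0; near: t; exact: nbhs_dnbhs_neq.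
have G_unit : \forall t \near s^', G t \in unitmx.
  near=> t; rewrite unitmxE unitfE; near: t.
  by apply: cvgr_neq0 detC; apply: cvg_det.
pose K t : 'M[R]_j.+1 := diag_mx (\row_k (t - s) ^+ k.+1).
pose D t : 'M[R]_j.+1 := diag_mx (\row_q ((t - s) ^+ tnth i q)^-1).
have GE t : G t = K t *m X t *m D t.
  rewrite /G /K /D; move: (X t) => Xt; apply/matrixP => k q.
  by rewrite mul_mx_diag mul_diag_mx !mxE.
have X_unit : \forall t \near s^', X t \in unitmx.
  near=> t; have : G t \in unitmx by near: t.
  by rewrite GE !unitmx_mul => /andP[/andP[]].
split=> // q y.
have invG_cvg := cvg_invmx _ C_unit G_cvg.
(* The inverse scaling by the power tnth i q costs no more than the power r that
   Q gains, whatever q. *)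
have rem_cvg : (t - s) ^+ (r - tnth i q) *
    (\sum_k invmx (G t) q k * ((t - s) ^+ k.+1 * Q t k y / (t - s) ^+ r))
    @[t --> s^'] --> (0 : R).
  rewrite [X in _ --> X](_ : 0 = 0 ^+ (r - tnth i q) * (\sum_k invmx C q k * 0)).
    apply: cvgM; first by apply: cvg_within_filter; exact: cvg_shift_pow.
    apply: cvg_big => [|k _]; first exact: add_continuous.
    by apply: cvgM; [exact: invG_cvg | exact: Q_cvg].
  by rewrite big1 ?mulr0 // => k _; rewrite mulr0.
have frame_cvg : E q y + (t - s) ^+ (r - tnth i q) *
    (\sum_k invmx (G t) q k * ((t - s) ^+ k.+1 * Q t k y / (t - s) ^+ r))
    @[t --> s^'] --> E q y.
  by rewrite -[X in _ --> X]addr0; apply: cvgD => //; exact: cvg_cst.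
apply: (cvg_trans (near_eq_cvg _) frame_cvg); near=> t.
have Gt_unit : G t \in unitmx by near: t.
have Xt_unit : X t \in unitmx by near: t.
have ts : t - s != 0 by near: t.
have WE : W t = X t *m E + Q t.
  by rewrite /X /Q mulmxBr mulmx1 -mulmxA addrC subrK.
have invXE : invmx (X t) = D t *m invmx (G t) *m K t.
  by move: Gt_unit; rewrite GE; apply: invmx_factor.
rewrite {2}WE -/(X t) mulmxDr mulKmx // invXE mxE; congr (_ + _).
rewrite -!mulmxA mul_diag_mx mxE mulr_sumr mxE [X in _ * X]mxE mulr_sumr.
apply: eq_bigr => k _; rewrite mul_diag_mx [X in _ * (_ * X)]mxE [(\row__ _) _ _]mxE.
have -> : (t - s) ^+ r = (t - s) ^+ (r - tnth i q) * (t - s) ^+ tnth i q.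
  by rewrite -exprD subnK.
rewrite invfM mulrCA [X in _ * X]mulrCA mulVKf ?expf_neq0 //.
by rewrite mulrA mulrC.
Unshelve. all: by end_near. Qed.
End OsculatingFrame.

(** * Osculating spaces *)

Section OsculatingSpace.
Variables (R : realType) (n j : nat) (a b : R) (c : R -> 'rV[R]_n).
Implicit Types (i : j.+1.-tuple nat) (s t : R).
Local Notation turning := (turning_indices a b c).
Local Notation smallest := (smallest_turning_indices a b c).

Lemma smallest_turning_unique s i i' : smallest s i -> smallest s i' -> i = i'.
Proof.
move=> [ti mi] [ti' mi']; apply: eq_from_tnth => x.
by apply/eqP; rewrite eqn_leq mi ?mi'.
Qed.

Lemma osculating_spaceE s i : smallest s i ->
  osculating_space a b j c s = affine_span (c s) (deriv_rows a b c s i).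
Proof.
move=> si; apply/seteqP; split=> [y [i' si']|y yi]; last by exists i.
by rewrite (smallest_turning_unique si' si).
Qed.

Lemma smallest_turning_exists s i0 : turning s i0 ->
  exists i, [/\ smallest s i & forall l, (0 < l <= tnth i ord_max)%N ->
    exists2 u : 'rV_j.+1, derivn_on `[a, b] l c s = u *m deriv_rows a b c s i &
      forall x, (l < tnth i x)%N -> u 0 x = 0].
Proof.
move=> [m [jm Cm [i01 i0_sorted] i0m]]; rewrite wedge_neq0 => i0_free.
have [i [[i1 i_sorted] i_free i_min flag]] :=
  minimal_free_rows (v := fun l => derivn_on `[a, b] l c s) i01 i0_sorted i0_free.
exists i; split=> //; split; last first.
  by move=> i' [m' [_ _ [i'1 i'_sorted] _]]; rewrite wedge_neq0 => /i_min; apply.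
exists m; split=> //; last by rewrite wedge_neq0.
by move=> x; apply: leq_ltn_trans (i0m x); apply: i_min.
Qed.

Definition first_indices : j.+1.-tuple nat := [tuple (val x).+1 | x < j.+1].

(** The k-th entry of an increasing tuple that starts at 1 is at least k, so the
    indices 1, ..., j+1 are smallest as soon as they are admissible. *)
Lemma first_indices_smallest t m : (j.+2 <= m)%N -> class_C_near `[a, b] m c t ->
  row_free (deriv_rows a b c t first_indices) -> smallest t first_indices.
Proof.
move=> jm Cm free; split.
  exists m; split=> //; last by rewrite wedge_neq0.
    split; first by rewrite tnth_mktuple.
    apply/(sortedP 0%N) => x; rewrite size_tuple => xj.
    have nthE (y : 'I_j.+1) : nth 0%N first_indices y = y.+1.
      by rewrite -tnth_nth tnth_mktuple.
    by rewrite (nthE (Ordinal (ltnW xj))) (nthE (Ordinal xj)) /=.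
  by move=> x; rewrite tnth_mktuple; apply: leq_trans jm; rewrite ltnS; exact: ltn_ord.
move=> i' [m' [_ _ [i'1 i'_sorted] _ _]] x; rewrite tnth_mktuple.
exact: tnth_sorted_ge.
Qed.

(** With W(t) the first j + 1 derivatives and X(t) their coordinates in the frame E
    at s, the basis X(t)^-1 W(t) of the direction at t is completed by E at t = s
    into a family that is continuous at s. *)
Lemma osculating_space_continuous s i0 : a < s < b -> turning s i0 ->
  plane_dist j.+1 (osculating_space a b j c t) (osculating_space a b j c s)
    @[t --> s] --> 0%E.
Proof.
move=> abs /smallest_turning_exists[i [si flag]].
have [m [jm Cm [i1 i_sorted] im]] := si.1; rewrite wedge_neq0 => E_free.
set E := deriv_rows a b c s i in flag E_free.
have near_itv : \forall t \near s, `]a, b[%classic t.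
  by apply: near_in_itvoo; rewrite in_itv.
have near_C : \forall t \near s, class_C_near `[a, b] m c t.
  pose P t := (forall k, (k < m)%N -> derivable_on `[a, b] (derivn_on `[a, b] k c) t) /\
    derivn_on `[a, b] m c x @[x --> within `[a, b] (nbhs t)] --> derivn_on `[a, b] m c t.
  have CE t : a < t < b -> class_C_near `[a, b] m c t = nbhs t P.
    by move=> abt; rewrite -(within_interior (within_itv_interior abt)).
  have P_near : \forall t \near s, nbhs t P by apply: nbhs_interior; rewrite -CE.
  near=> t; rewrite CE; first by near: t.
  have : `]a, b[%classic t by near: t.
  by rewrite /= in_itv.
have [X_unit frame] :
    (\forall t \near s^',
       deriv_rows a b c t first_indices *m pinvmx E \in unitmx) /\
    forall p q, (invmx (deriv_rows a b c t first_indices *m pinvmx E)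
      *m deriv_rows a b c t first_indices) p q @[t --> s^'] --> E p q.
  apply: (@frame_convergence R n j m (fun k => derivn_on `[a, b] k c) s i) => //.
  - by move=> u k km; case: (class_C_component u abs Cm) => + _; apply.
  - by move=> u k km; case: (class_C_component u abs Cm) => _; apply.
  - by move=> x; rewrite im andbT; apply: leq_ltn_trans (tnth_sorted_ge x i1 i_sorted).
  - by move=> x; rewrite rowK.
  - by move=> t k; rewrite rowK tnth_mktuple.
pose M t := if t == s then E else
  invmx (deriv_rows a b c t first_indices *m pinvmx E)
    *m deriv_rows a b c t first_indices.
have Ms : M s = E by rewrite /M eqxx.
have M_cvg p q : M t p q @[t --> s] --> M s p q.
  have : {for s, continuous (fun t => M t p q)}; last exact.
  apply/continuous_withinNx; rewrite Ms.
  apply: (cvg_trans (near_eq_cvg _) (frame p q)); near=> t.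
  rewrite /M ifF //; apply/negbTE; near: t; exact: nbhs_dnbhs_neq.
have Ms_free : row_free (M s) by rewrite Ms.
apply: (cvg_trans (near_eq_cvg _) (plane_dist_cvg0 c Ms_free M_cvg)).
have osc_punctured :
    \forall t \near s^', osculating_space a b j c t = affine_span (c t) (M t).
  near=> t.
  have Xt : deriv_rows a b c t first_indices *m pinvmx E \in unitmx by near: t.
  have t_free : row_free (deriv_rows a b c t first_indices).
    apply/row_freeP.
    exists (pinvmx E *m invmx (deriv_rows a b c t first_indices *m pinvmx E)).
    by rewrite mulmxA mulmxV.
  have Ct : class_C_near `[a, b] m c t by near: t; apply: nbhs_dnbhs.
  rewrite (osculating_spaceE (first_indices_smallest jm Ct t_free)).
  rewrite /M ifF ?affine_span_unit ?unitmx_inv //.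
  by apply/negbTE; near: t; exact: nbhs_dnbhs_neq.
have osc_s : osculating_space a b j c s = affine_span (c s) (M s).
  by rewrite Ms; exact: osculating_spaceE.
have osc_near :
    \forall t \near s, osculating_space a b j c t = affine_span (c t) (M t).
  apply: (@filterS _ (nbhs s) _ _ _ _ osc_punctured) => t osc_t.
  by have [-> //|] := eqVneq t s.
apply: filterS osc_near => t osc_t /=.
by rewrite osc_t osc_s.
Unshelve. all: by end_near. Qed.

End OsculatingSpace.

Theorem proposition7p8 (R : realType) (N j : nat) (a b : R)
    (c : R -> 'rV[R]_N.+1) :
  (3 <= N)%N -> (1 <= j <= N)%N -> a < b ->
  rectifiable a b c -> arclength_parametrized a b c ->
  mildly_smoothly_turning a b j c ->
  (forall s : R, a < s < b ->
     exists! i, smallest_turning_indices (j := j) a b c s i) /\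
  (forall s : R, a < s < b ->
     plane_dist j.+1 (osculating_space a b j c t) (osculating_space a b j c s)
       @[t --> s] --> 0%E).
Proof.
move=> _ _ _ _ _ turning.
have turning_in s : a < s < b -> exists i, turning_indices (j := j) a b c s i.
  by case/andP=> /ltW a_s /ltW s_b; apply: turning; rewrite a_s.
split=> s abs; have [i0 ti0] := turning_in s abs.
  have [i [si _]] := smallest_turning_exists ti0.
  by exists i; split=> // i' si'; exact: smallest_turning_unique si si'.
exact: osculating_space_continuous ti0.
Qed.
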